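(* Let $V$ be a vector space over a field, let $W$ be a subspace of $V$, and let $\mathbb{S}(W)$ be a subsemigroup of $L(W)$ such that $I_W\in\mathbb{S}(W)$. Then $L_{\mathbb{S}(W)}(V)$ is a unit-regular semigroup if and only if one of the following holds: (i) $\mathbb{S}(W)$ is a subgroup of $\mathrm{Aut}(W)$ and $\mathrm{codim}(W)$ is finite; (ii) $\mathbb{S}(W)$ is unit-regular and $W=V$.
   Context: For a vector space $U$, $L(U)$ is the semigroup of all linear maps $U\to U$ under composition (composed from left to right, with $vf$ denoting the image of $v$ under $f$), $I_U$ is the identity map on $U$, and $\mathrm{Aut}(U)$ is the group of all linear automorphisms of $U$. For $f\in L(V)$ with $Wf\subseteq W$, $f_{\upharpoonright_W}\in L(W)$ denotes the linear map $W\to W$ that agrees with $f$ on $W$. Define $L_{\mathbb{S}(W)}(V)=\{f\in L(V) : Wf\subseteq W \text{ and } f_{\upharpoonright_W}\in\mathbb{S}(W)\}$, a subsemigroup of $L(V)$; it contains $I_V$ when $I_W\in\mathbb{S}(W)$. $\mathrm{codim}(W)=\dim(V/W)$. In a semigroup $S$ with identity, $U(S)$ is the set of units of $S$, and $a\in S$ is unit-regular if there is $u\in U(S)$ with $aua=a$; $S$ is unit-regular if all its elements are unit-regular. *)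

(* Defs.v *)
From HB Require Import structures.
From mathcomp Require Import all_boot all_order all_algebra.
From mathcomp Require Import boolp classical_sets.

Set Implicit Arguments.
Unset Strict Implicit.
Unset Printing Implicit Defensive.

Import GRing.Theory.
Local Open Scope ring_scope.
Local Open Scope quotient_scope.
Local Open Scope classical_set_scope.

(* Semigroups are carried by subsets of an ambient [magmaType]; the identity of
   such a semigroup is its own, not one inherited from the ambient structure. *)
Section Semigroups.
Local Open Scope group_scope.
Variable M : magmaType.
Implicit Type S : set M.

Definition subsemigroup S := forall a b, S a -> S b -> S (a * b).

Definition is_identity S (e : M) :=
  S e /\ forall a, S a -> e * a = a /\ a * e = a.

Definition sg_unit S (u : M) :=
  S u /\ exists e, is_identity S e /\
         exists v, S v /\ u * v = e /\ v * u = e.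

Definition unit_regular_elt S (a : M) :=
  exists u, sg_unit S u /\ a * u * a = a.

Definition unit_regular S := forall a, S a -> unit_regular_elt S a.

End Semigroups.

Definition lendo (K : fieldType) (U : lmodType K) : Type := {linear U -> U}.

HB.instance Definition _ (K : fieldType) (U : lmodType K) :=
  gen_eqMixin (lendo U).
HB.instance Definition _ (K : fieldType) (U : lmodType K) :=
  gen_choiceMixin (lendo U).

Section LEndo.
Variables (K : fieldType) (U : lmodType K).
Implicit Types f g h : lendo U.

Lemma lendo_ext f g : f =1 g -> f = g.
Proof.
case: f g => [f [[hfD] [hfZ]]] [g [[hgD] [hgZ]]] /= /funext efg.
by subst g; rewrite (Prop_irrelevance hfD hgD) (Prop_irrelevance hfZ hgZ).
Qed.

(* Maps compose from left to right: [f * g] is [f] followed by [g]. *)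
Definition lendo_mul f g : lendo U := GRing.Linear.clone _ _ _ _ (g \o f) _.
Definition lendo_one : lendo U := GRing.Linear.clone _ _ _ _ (@idfun U) _.

Fact lendo_mulA : associative lendo_mul.
Proof. by move=> f g h; apply: lendo_ext. Qed.
Fact lendo_mul1 : left_id lendo_one lendo_mul.
Proof. by move=> f; apply: lendo_ext. Qed.
Fact lendo_mulr1 : right_id lendo_one lendo_mul.
Proof. by move=> f; apply: lendo_ext. Qed.

HB.instance Definition _ :=
  isMonoid.Build (lendo U) lendo_mulA lendo_mul1 lendo_mulr1.

Definition lin_Aut : set (lendo U) := [set f | bijective f].

Definition Aut_subgroup (S : set (lendo U)) :=
  [/\ S `<=` lin_Aut, S 1%g, subsemigroup S
    & forall f g, S f -> cancel f g -> cancel g f -> S g].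

Definition finite_dim := exists n, inhabited (Vector.axiom n U).

End LEndo.

Section Submodules.
Variables (K : fieldType) (V : lmodType K) (W : submodClosed V).

Definition submod_of : Type := {v : V | v \in W}.
HB.instance Definition _ := SubChoice.on submod_of.
HB.instance Definition _ := [SubChoice_isSubLmodule of submod_of by <:].

Definition stable (f : lendo V) := forall w, w \in W -> f w \in W.

Section Restriction.
Variables (f : lendo V) (fW : stable f).

Definition restrict_fun (w : submod_of) : submod_of :=
  Sub (f (val w)) (fW (valP w)).

Fact restrict_fun_linear : linear restrict_fun.
Proof.
by move=> a u v; apply: val_inj; rewrite /= [LHS](linearP f).
Qed.

HB.instance Definition _ :=
  GRing.isLinear.Build K submod_of submod_of *:%R restrict_fun
    restrict_fun_linear.

Definition restrict : lendo submod_of := GRing.Linear.clone _ _ _ _ restrict_fun _.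

End Restriction.

Definition LS (S : set (lendo submod_of)) : set (lendo V) :=
  [set f | exists fW : stable f, S (restrict fW)].

Fact submod_zmod_closed : zmod_closed W.
Proof.
split=> [|u v Wu Wv]; first exact: rpred0.
by rewrite rpredD // -scaleN1r rpredZ.
Qed.

(* A copy of [W] registered as a subgroup, so that [Quotient.quot] applies. *)
Definition submod_zmod : {pred V} := fun v => v \in W.
HB.instance Definition _ :=
  GRing.isZmodClosed.Build V submod_zmod submod_zmod_closed.

Definition quotmod : Type := Quotient.quot submod_zmod.
HB.instance Definition _ := EqQuotient.on quotmod.
HB.instance Definition _ := GRing.Zmodule.on quotmod.

Definition quotmod_scale (a : K) (x : quotmod) : quotmod :=
  \pi_quotmod (a *: repr x).

Fact pi_quotmod_scale (a : K) (v : V) :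
  \pi_quotmod (a *: v) = quotmod_scale a (\pi_quotmod v).
Proof.
apply/eqP; rewrite -Quotient.idealrBE -scalerBr.
by apply: rpredZ; rewrite -[_ \in W]/(_ \in submod_zmod) Quotient.idealrBE reprK.
Qed.

Fact pi_quotmodD (u v : V) :
  \pi_quotmod (u + v) = \pi_quotmod u + \pi_quotmod v.
Proof. by rewrite !piE. Qed.

Fact quotmod_scaleA a b x :
  quotmod_scale a (quotmod_scale b x) = quotmod_scale (a * b) x.
Proof.
elim/quotW: x => v.
rewrite -(pi_quotmod_scale b v) -(pi_quotmod_scale a) -(pi_quotmod_scale _ v).
by rewrite scalerA.
Qed.

Fact quotmod_scale1 : left_id 1 quotmod_scale.
Proof. by elim/quotW=> v; rewrite -(pi_quotmod_scale 1 v) scale1r. Qed.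

Fact quotmod_scaleDr : right_distributive quotmod_scale +%R.
Proof.
move=> a; elim/quotW=> u; elim/quotW=> v.
rewrite -(pi_quotmodD u v) -(pi_quotmod_scale a (u + v)).
rewrite -(pi_quotmod_scale a u) -(pi_quotmod_scale a v).
by rewrite -(pi_quotmodD (a *: u)) scalerDr.
Qed.

Fact quotmod_scaleDl x : {morph quotmod_scale^~ x : a b / a + b}.
Proof.
elim/quotW: x => v a b; rewrite -(pi_quotmod_scale (a + b) v) scalerDl.
by rewrite (pi_quotmodD (a *: v)) (pi_quotmod_scale a) (pi_quotmod_scale b).
Qed.

HB.instance Definition _ :=
  GRing.Zmodule_isLmodule.Build K quotmod
    quotmod_scaleA quotmod_scale1 quotmod_scaleDr quotmod_scaleDl.

End Submodules.

(* Main.v *)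
(* Suppose L_S(V) is unit-regular. Extending s in S by 0 along a complement of W
   shows that S is unit-regular. If W <> V, an extension of s may send a vector
   outside W to any prescribed w0 in W, and an inner inverse preserving W then
   forces w0 to be in the image of s; so s is onto, hence a unit of S. An injective
   unit-regular map is bijective, whereas an infinite-dimensional V / W would
   allow a one-sided shift acting as the identity on W. Conversely, when S is a
   group of automorphisms and V / W is finite dimensional, composing f with an
   automorphism fixing W pointwise makes f block diagonal, and a square matrix A
   has an invertible B with A B A = A. *)
Require Import Defs.
From HB Require Import structures.
From mathcomp Require Import all_boot all_order all_algebra.
From mathcomp Require Import boolp classical_sets.

Import GRing.Theory.

Set Implicit Arguments.
Unset Strict Implicit.
Unset Printing Implicit Defensive.

(** * Linear algebra in arbitrary dimension *)

Section LinearMaps.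
Local Open Scope classical_set_scope.
Local Open Scope ring_scope.
Variable K : fieldType.

Lemma linear_fun_ex (X Y : lmodType K) (f : X -> Y) :
  linear f -> exists g : {linear X -> Y}, g =1 f.
Proof.
move=> lf; pose F := GRing.isLinear.Build K X Y *:%R f lf.
by exists (HB.pack_for {linear X -> Y} f F).
Qed.

Lemma lin_Aut_inverse (U : lmodType K) (f : lendo U) :
  lin_Aut f -> exists2 g : lendo U, cancel f g & cancel g f.
Proof.
case=> g fK gK; have [h hE] := linear_fun_ex (can2_linear fK gK).
by exists h => x; rewrite hE.
Qed.

(* A submodule maximal among those meeting the image of [phi] trivially is a
   complement of that image. *)
Lemma linear_left_inverse (X Y : lmodType K) (phi : {linear X -> Y}) :
  injective phi -> exists r : {linear Y -> X}, cancel phi r.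
Proof.
move=> phi_inj.
pose P (C : set Y) := (forall a u v, C u -> C v -> C (a *: u + v)) /\
  (forall x, C (phi x) -> x = 0).
have [|C [[Clin Cphi] Cmax]] := @Zorn_bigcup Y P.
  move=> F FP Ftot; split=> [a u v [A FA Au] [B FB Bv] | x [A FA]]; last first.
    by have [_] := FP _ FA; apply.
  have [AB|BA] := Ftot _ _ FA FB.
    by exists B => //; have [+ _] := FP _ FB; apply=> //; apply: AB.
  by exists A => //; have [+ _] := FP _ FA; apply=> //; apply: BA.
(* The empty set satisfies [P], so [0] in [C] is not automatic; an empty [C] would lie strictly
   inside [[set 0]]. *)
have C0 : C 0.
  have [//|nC0] := pselect (C 0).
  have noC y : ~ C y.
    by move=> Cy; apply: nC0; rewrite -(addNr y) -scaleN1r; apply: Clin.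
  have PZ : P [set 0].
    split=> [a u v /= -> ->|x /= xE]; first by rewrite scaler0 addr0.
    by apply: phi_inj; rewrite xE linear0.
  exfalso; apply: (Cmax _ _ PZ); split=> [y /noC //|].
  by move/(_ 0)/(_ erefl)/nC0.
have CZ a u : C u -> C (a *: u).
  by move=> Cu; rewrite -[_ *: _]addr0; apply: Clin.
have split_ex y : exists x, C (y - phi x).
  have [//|no] := pselect (exists x, C (y - phi x)).
  (* [D] is the span of [C] and [y]. A nonzero [phi x] in it has coefficient [a != 0] on [y], which
     puts [y - phi (a^-1 *: x)] in [C]. *)
  pose D := [set z | exists a u, C u /\ z = a *: y + u].
  have CD : C `<=` D by move=> u Cu; exists 0, u; rewrite scale0r add0r.
  exfalso; apply: (Cmax D).
    split=> // DC; apply: no; exists 0; rewrite linear0 subr0.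
    by apply: DC; exists 1, 0; rewrite scale1r addr0.
  split=> [a _ _ [b [u [Cu ->]]] [c [v [Cv ->]]]|x [a [u [Cu xE]]]].
    exists (a * b + c), (a *: u + v); split; first exact: Clin.
    by rewrite scalerDr scalerA scalerDl addrACA.
  have [a0|a_neq0] := eqVneq a 0.
    by apply: Cphi; rewrite xE a0 scale0r add0r.
  exfalso; apply: no; exists (a^-1 *: x); rewrite linearZ /= xE scalerDr scalerA.
  by rewrite mulVf // scale1r opprD addNKr -scaleNr; apply: CZ.
have [r rP] := choice split_ex.
have r_uniq y x : C (y - phi x) -> r y = x.
  move=> Cy; apply/eqP; rewrite -subr_eq0; apply/eqP; apply: Cphi.
  have -> : phi (r y - x) = -1 *: (y - phi (r y)) + (y - phi x).
    by rewrite linearB scaleN1r opprB addrA subrK.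
  exact: Clin.
have lr : linear r.
  move=> a u v; apply: r_uniq; rewrite linearP opprD addrACA -scalerBr.
  exact: Clin.
have [g gE] := linear_fun_ex lr.
by exists g => x; rewrite gE; apply: r_uniq; rewrite subrr.
Qed.

(** Polynomials serve as finitely supported coefficient sequences: ['X^n] goes to [e n], and
    multiplication by ['X] shifts indices. *)
Definition lcomb (U : lmodType K) (e : nat -> U) (p : {poly K}) : U :=
  \sum_(i < size p) p`_i *: e i.

Lemma lcomb_widen (U : lmodType K) (e : nat -> U) n (p : {poly K}) :
  (size p <= n)%N -> lcomb e p = \sum_(i < n) p`_i *: e i.
Proof.
move=> le_p_n; rewrite /lcomb (big_ord_widen _ (fun i => p`_i *: e i) le_p_n).
rewrite big_mkcond; apply: eq_bigr => i _.
by case: ltnP => // le_p_i; rewrite nth_default ?scale0r.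
Qed.

Lemma lcomb_linear (U : lmodType K) (e : nat -> U) : linear (lcomb e).
Proof.
move=> a p q; pose n := maxn (size (a *: p + q)) (maxn (size p) (size q)).
rewrite !(@lcomb_widen _ _ n) ?leq_max ?leqnn ?orbT //.
rewrite scaler_sumr -big_split; apply: eq_bigr => i _ /=.
by rewrite coefD coefZ scalerDl scalerA.
Qed.

HB.instance Definition _ (U : lmodType K) (e : nat -> U) :=
  GRing.isLinear.Build K {poly K} U *:%R (lcomb e) (lcomb_linear e).

Lemma linear_lcomb (U U' : lmodType K) (f : {linear U -> U'}) (e : nat -> U) p :
  f (lcomb e p) = lcomb (f \o e) p.
Proof. by rewrite linear_sum; apply: eq_bigr => i _; rewrite linearZ. Qed.

Lemma finite_dim_of_basis (U : lmodType K) (e : nat -> U) n :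
  (forall u, exists2 p : {poly K}, (size p <= n)%N & u = lcomb e p) ->
  (forall p : {poly K}, (size p <= n)%N -> lcomb e p = 0 -> p = 0) -> finite_dim U.
Proof.
move=> e_gen e_free; exists n.
have lf : linear (fun c : 'rV[K]_n => lcomb e (rVpoly c)).
  by move=> a u v; rewrite linearP linearP.
have [f fE] := linear_fun_ex lf.
have [g gP] : {g : U -> 'rV_n & forall u, f (g u) = u}.
  apply: (@choice _ _ (fun u c => f c = u)) => u; have [p le_p ->] := e_gen u.
  by exists (poly_rV p); rewrite fE poly_rV_K.
have fI : injective f.
  apply: raddf_inj => c /(etrans (esym (fE c)))/e_free rc0.
  by apply: (can_inj rVpolyK); rewrite rc0 ?linear0 //; apply: size_poly.
have fK : cancel f g by move=> c; apply: fI; rewrite gP.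
constructor; exists g; first exact: (can2_linear fK gP).
by exists f.
Qed.

(** Each [e n] is chosen outside the span of its predecessors; if some finite stage spanned [U], it
    would be a basis. *)
Lemma infinite_free_sequence (U : lmodType K) : ~ finite_dim U ->
  exists e : nat -> U, forall p, lcomb e p = 0 -> p = 0.
Proof.
move=> infU.
have [next nextP] : {next : set U -> U &
    forall A, (exists x, ~ A x) -> ~ A (next A)}.
  apply: (@choice _ _ (fun A u => (exists x, ~ A x) -> ~ A u)) => A.
  by have [[x Ax]|no] := pselect (exists x, ~ A x); [exists x|exists 0 => /no].
(* [A n] is the span of the first [n] chosen vectors; [next] depends on the set alone, so the
   recursion carries only the span. *)
pose A := fix A n : set U := if n is m.+1 then
  [set x | exists a y, A m y /\ x = a *: next (A m) + y] else [set 0].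
pose e n := next (A n).
have AP n (p : {poly K}) : (size p <= n)%N -> A n (lcomb e p).
  elim: n p => [|n IHn] p le_p_n.
    have -> : p = 0 by apply/eqP; rewrite -size_poly_eq0 -leqn0.
    by rewrite linear0.
  exists p`_n, (lcomb e (take_poly n p)); split.
    by apply: IHn; apply: size_take_poly.
  rewrite (lcomb_widen e le_p_n) big_ord_recr /= addrC; congr (_ + _).
  rewrite (lcomb_widen e (size_take_poly n p)).
  by apply: eq_bigr => i _; rewrite coef_take_poly ltn_ord.
have AE n x : A n x -> exists2 p : {poly K}, (size p <= n)%N & x = lcomb e p.
  elim: n x => [|n IHn] x /=.
    by move=> ->; exists 0; rewrite ?size_poly0 ?linear0.
  case=> a [y [/IHn[p le_p_n ->] ->]]; exists (a *: 'X^n + p).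
    apply: (leq_trans (size_polyD _ _)); rewrite geq_max (leq_trans le_p_n) // andbT.
    by apply: (leq_trans (size_scale_leq _ _)); rewrite size_polyXn.
  rewrite linearD linearZ /=; congr (a *: _ + _).
  rewrite /lcomb size_polyXn big_ord_recr /= coefXn eqxx scale1r big1 ?add0r // => i _.
  by rewrite coefXn ltn_eqF ?scale0r.
have free n : (forall i, (i < n)%N -> ~ A i (e i)) ->
    forall p : {poly K}, (size p <= n)%N -> lcomb e p = 0 -> p = 0.
  move=> e_out p le_p_n p0; apply/eqP/negPn/negP => p_neq0.
  have sz_p : (0 < size p)%N by rewrite size_poly_gt0.
  (* Dividing by the leading coefficient expresses the last vector of the relation through earlier
     ones. *)
  apply: (e_out (size p).-1); first by rewrite prednK.
  have le_p : (size p <= (size p).-1.+1)%N by rewrite prednK.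
  have lc : lead_coef p != 0 by rewrite lead_coef_eq0.
  pose q := take_poly (size p).-1 p.
  have -> : e (size p).-1 = lcomb e (- (lead_coef p)^-1 *: q).
    rewrite linearZ /= (lcomb_widen e (size_take_poly _ _)).
    under eq_bigr => i _ do rewrite coef_take_poly ltn_ord.
    move: p0; rewrite (lcomb_widen e le_p) big_ord_recr /= => /eqP.
    rewrite addr_eq0 => /eqP ->.
    by rewrite scalerN scaleNr opprK scalerA mulVf ?scale1r.
  apply: AP; apply: (leq_trans (size_scale_leq _ _)).
  exact: size_take_poly.
have e_out n : ~ A n (e n).
  elim/ltn_ind: n => n IHn; apply: nextP; apply: contrapT => no.
  apply: infU; apply: (@finite_dim_of_basis _ e n); last exact: free.
  by move=> u; apply: AE; apply: contrapT => nAu; apply: no; exists u.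
by exists e => p; apply: (free (size p)).
Qed.

(** Rank normal form writes [A] as [C *m P *m R] with [C], [R] invertible and [P] idempotent; [B] is
    the product of the inverses of [R] and [C]. *)
Lemma mulmx_inner_inverse n (A : 'M[K]_n) :
  exists2 B : 'M_n, B \in unitmx & A *m B *m A = A.
Proof.
exists (invmx (row_ebase A) *m invmx (col_ebase A)).
  by rewrite unitmx_mul !unitmx_inv row_ebase_unit col_ebase_unit.
rewrite -{1 4 5}(mulmx_ebase A) -!mulmxA; congr (_ *m _).
rewrite (mulmxA (row_ebase A)) mulmxV ?row_ebase_unit // mul1mx.
rewrite (mulmxA (invmx _)) mulVmx ?col_ebase_unit // mul1mx.
by rewrite mulmxA pid_mx_id ?rank_leq_row.
Qed.

End LinearMaps.

(** As [S] contains [1], its own identity must be [1], so its units are the bijections in [S] with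
    inverse in [S]. *)
Lemma unit_regular_lendoP (K : fieldType) (U : lmodType K) (S : set (lendo U)) :
  S 1%g -> unit_regular S <->
  forall f, S f -> exists u v : lendo U,
    [/\ S u, S v, cancel u v, cancel v u & forall x, f (u (f x)) = f x].
Proof.
move=> S1; split=> regS f /regS.
  case=> u [[Su [e [[Se eP] [v [Sv [uv vu]]]]]] fuf].
  have e1 : e = 1%g by have [+ _] := eP _ S1; rewrite mulg1.
  rewrite e1 in uv vu; exists u, v; split=> // x.
  - by rewrite -[RHS]/((1%g : lendo U) x) -uv.
  - by rewrite -[RHS]/((1%g : lendo U) x) -vu.
  - by rewrite -[in RHS]fuf.
case=> u [v [Su Sv uK vK fuf]]; exists u; split; last exact: lendo_ext.
split=> //; exists 1%g; split.
  by split=> // a _; rewrite mul1g mulg1.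
by exists v; split=> //; split; apply: lendo_ext.
Qed.

(** * Quotient, retraction, and necessity of the conditions *)

Section SubmoduleStable.
Local Open Scope classical_set_scope.
Local Open Scope ring_scope.
Local Open Scope quotient_scope.
Variables (K : fieldType) (V : lmodType K) (W : submodClosed V).
Local Notation U := (submod_of W).

Lemma quotmod_proj : exists pi : {linear V -> quotmod W},
  (forall v, pi v = 0 <-> v \in W) /\ forall q, exists v, pi v = q.
Proof.
have lpi : linear (fun v : V => \pi_(quotmod W) v).
  by move=> a u v; rewrite pi_quotmodD pi_quotmod_scale.
have [pi piE] := linear_fun_ex lpi; exists pi; split=> [v|q].
  have pi0 : \pi_(quotmod W) 0 = 0 by rewrite -piE linear0.
  rewrite piE -pi0 -[v \in W]/(v \in submod_zmod W) -[v in v \in _]subr0.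
  by rewrite Quotient.idealrBE; split=> /eqP.
by exists (repr q); rewrite piE reprK.
Qed.

Lemma submod_retraction : exists p : {linear V -> U},
  cancel (val : U -> V) p.
Proof. exact: linear_left_inverse val_inj. Qed.

Variables (S : set (lendo U)) (S_one : S 1%g).

Lemma LS_restrictP (f : lendo V) :
  LS S f <-> exists2 s : lendo U, S s & forall w, f (val w) = val (s w).
Proof.
split=> [[fW Sf]|[s Ss fs]]; first by exists (restrict fW).
have fW : stable W f by move=> w Ww; rewrite -[w]/(val (Sub w Ww : U)) fs; apply: valP.
exists fW; suff -> : restrict fW = s by [].
by apply: lendo_ext => w; apply: val_inj; rewrite /= fs.
Qed.

Lemma LS_one : LS S 1%g.
Proof. by apply/LS_restrictP; exists 1%g. Qed.

Hypothesis regLS : forall f, LS S f -> exists u v : lendo V,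
  [/\ LS S u, LS S v, cancel u v, cancel v u & forall x, f (u (f x)) = f x].

Lemma LS_regular_restrict f : S f -> exists u v : lendo U,
  [/\ S u, S v, cancel u v, cancel v u & forall x, f (u (f x)) = f x].
Proof.
move=> Sf; have [p pK] := submod_retraction.
pose F : {linear V -> V} := GRing.Linear.clone _ _ _ _ ((val : U -> V) \o f \o p) _.
have FE w : F (val w) = val (f w) by rewrite /= pK.
have [|u [v [/LS_restrictP[u' Su uE] /LS_restrictP[v' Sv vE] uK vK fuf]]] :=
  regLS (f := F); first by apply/LS_restrictP; exists f.
exists u', v'; split=> // w; apply: val_inj.
- by rewrite -vE -uE uK.
- by rewrite -uE -vE vK.
- by have := fuf (val w); rewrite !FE uE FE.
Qed.

(* If [w0] is not in the image of [s], the extension of [s] sending some vector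
   outside [W] to [w0] has no inner inverse preserving [W]. *)
Lemma LS_regular_surj v s : v \notin W -> S s -> forall w0, exists w, s w = w0.
Proof.
move=> Wv Ss w0; have [p pK] := submod_retraction.
have [pi [pi0 _]] := quotmod_proj.
have piW (w : U) : pi (val w) = 0 by apply/pi0; apply: valP.
have piv_neq0 : pi v != 0 by apply: contra Wv => /eqP/pi0.
have [l lK] : exists l : {linear quotmod W -> K^o}, forall a : K, l (a *: pi v) = a.
  have lin : linear (fun a : K^o => (a : K) *: pi v).
    by move=> a x y; rewrite scalerDl scalerA.
  have [g gE] := linear_fun_ex lin.
  have [|l lK] := @linear_left_inverse _ _ _ g; last by exists l => a; rewrite -gE lK.
  apply: raddf_inj => a /(etrans (esym (gE a)))/eqP.
  by rewrite scaler_eq0 (negPf piv_neq0) orbF => /eqP.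
have lf : linear (fun x => val (s (p x)) + (l (pi x) : K) *: val w0).
  by move=> a x y; rewrite !linearP /= scalerDl addrACA scalerDr scalerA.
have [f fE] := linear_fun_ex lf.
have fW w : f (val w) = val (s w).
  by rewrite fE pK piW linear0 scale0r addr0.
have [|u [_ [/LS_restrictP[u' _ uE] _ _ _ fuf]]] := @regLS f.
  by apply/LS_restrictP; exists s.
exists (u' w0); apply: val_inj; rewrite -fW -uE.
(* Removing the [W] component of [v] keeps its class modulo [W] and kills the term in [s]. *)
have fv : f (v - val (p v)) = val w0.
  have p0 : p (v - val (p v)) = 0 by rewrite linearB /= pK subrr.
  have piv : pi (v - val (p v)) = pi v by rewrite linearB /= piW subr0.
  by rewrite fE p0 piv !linear0 add0r -[pi v]scale1r lK scale1r.
by rewrite -fv fuf.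
Qed.

(** Surjectivity of [s] turns [s (t (s x)) = s x] into [cancel t s]; bijectivity of [t] then gives
    [cancel s t]. *)
Lemma LS_regular_Aut v : v \notin W -> subsemigroup S -> Aut_subgroup S.
Proof.
move=> Wv S_mul.
have inv s : S s -> exists2 t : lendo U, S t & cancel s t /\ cancel t s.
  move=> Ss; have [t [t' [St _ tK t'K sts]]] := LS_regular_restrict Ss.
  have tsK : cancel t s.
    by move=> w; have [w' <-] := LS_regular_surj Wv Ss w.
  by exists t => //; split=> // w; rewrite -[w]t'K tsK.
split=> // [s /inv[t _ [sK tK]]|s g Ss sK gK]; first by exists t.
have [t St [_ tK]] := inv _ Ss.
suff -> : g = t by [].
by apply: lendo_ext => x; rewrite -{1}[x]tK sK.
Qed.

(* If [V / W] is infinite dimensional, a copy of [{poly K}] splits off [V]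
   away from [W]; multiplication by ['X] on it is injective, not surjective. *)
Lemma LS_regular_codim : finite_dim (quotmod W).
Proof.
apply: contrapT => /infinite_free_sequence[e e_free].
have [pi [pi0 pi_surj]] := quotmod_proj.
have piW (w : U) : pi (val w) = 0 by apply/pi0; apply: valP.
have [e' e'P] := choice (fun n => pi_surj (e n)).
have [|r rK] := @linear_left_inverse _ _ _ (lcomb e : {linear _ -> _}).
  by apply: raddf_inj.
pose phi : {linear {poly K} -> V} := lcomb e'.
have rphi p : r (pi (phi p)) = p.
  by rewrite linear_lcomb -[RHS]rK; congr (r (lcomb _ _)); apply/funext.
pose R : {linear V -> {poly K}} := GRing.Linear.clone _ _ _ _ (r \o pi) _.
(* As [R] is a left inverse of [phi], this map multiplies the [R] coordinate by ['X]; it fixes [W]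
   pointwise because [R] vanishes there. *)
have lf : linear (fun x => x + phi (('X - 1) * R x)).
  move=> a x y; rewrite (linearP R) mulrDr -scalerAr (linearP phi).
  by rewrite addrACA -scalerDr.
have [f fE] := linear_fun_ex lf.
have Rf x : R (f x) = 'X * R x.
  by rewrite fE (linearD R) [R (phi _)]rphi mulrBl mul1r addrCA subrr addr0.
have [|u [v [_ _ uK vK fuf]]] := @regLS f.
  apply/LS_restrictP; exists 1%g => // w.
  by rewrite fE [R _](congr1 r (piW w)) linear0 mulr0 linear0 addr0.
have f_inj : injective f.
  apply: raddf_inj => x fx0.
  have Rx0 : R x = 0.
    have := Rf x; rewrite [f x]fx0 (linear0 R) => /esym/eqP.
    by rewrite mulf_eq0 polyX_eq0 => /eqP.
  by have := fE x; rewrite [f x]fx0 Rx0 mulr0 linear0 addr0.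
have ufK x : u (f x) = x by apply: f_inj; apply: fuf.
have fuK y : f (u y) = y by apply: (can_inj uK); rewrite ufK.
(* Surjectivity of [f] makes [1] a multiple of ['X], which evaluation at [0] refutes. *)
have := Rf (u (phi 1)); rewrite fuK /R /= rphi => /(congr1 (horner^~ 0)).
by rewrite hornerM hornerX mul0r hornerC => /eqP; rewrite oner_eq0.
Qed.

End SubmoduleStable.

(** * Sufficiency of the conditions *)

Section AutStable.
Local Open Scope classical_set_scope.
Local Open Scope ring_scope.
Variables (K : fieldType) (V : lmodType K) (W : submodClosed V).
Local Notation U := (submod_of W).

(** A basis of the quotient is lifted to [V] and corrected by [p], so that the lifts span the kernel
    of [p], a complement of [W]. *)
Lemma finite_codim_decomposition : finite_dim (quotmod W) ->
  exists n (p : {linear V -> U}) (b : {linear V -> 'rV[K]_n})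
           (j : {linear 'rV[K]_n -> V}),
    [/\ cancel (val : U -> V) p, cancel j b,
        forall w : U, b (val w) = 0, forall c, p (j c) = 0
      & forall x, x = val (p x) + j (b x)].
Proof.
case=> n [[v2r lv2r v2r_bij]]; have [g gE] := linear_fun_ex lv2r.
have [h hK vK] := v2r_bij.
have [pi [pi0 pi_surj]] := quotmod_proj W.
have [p pK] := submod_retraction W.
pose b : {linear V -> 'rV[K]_n} := GRing.Linear.clone _ _ _ _ (g \o pi) _.
have bW (w : U) : b (val w) = 0.
  by have /pi0 piw := valP w; rewrite /b /= piw linear0.
have [x bx] : {x : 'I_n -> V & forall i, b (x i) = delta_mx 0 i}.
  apply: (@choice _ _ (fun i x => b x = delta_mx 0 i)) => i.
  by have [x xE] := pi_surj (h (delta_mx 0 i)); exists x; rewrite /b /= gE xE vK.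
pose y i := x i - val (p (x i)).
have lj : linear (fun c : 'rV[K]_n => \sum_i c 0 i *: y i).
  move=> a c d; rewrite scaler_sumr -big_split; apply: eq_bigr => i _ /=.
  by rewrite !mxE scalerDl scalerA.
have [j jE] := linear_fun_ex lj; exists n, p, b, j.
have jK : cancel j b.
  move=> c; rewrite jE linear_sum [RHS]row_sum_delta; apply: eq_bigr => i _.
  by rewrite linearZ /= [g _](linearB b) [b (val _)]bW subr0 bx.
have pj c : p (j c) = 0.
  rewrite jE linear_sum big1 // => i _.
  by rewrite linearZ /= linearB /= pK subrr scaler0.
split=> // z.
have /pi0 Wz : pi (z - j (b z)) = 0.
  apply: (bij_inj v2r_bij); rewrite -!gE linear0.
  by rewrite [g _](linearB b) [b (j _)]jK subrr.
have := pK (Sub (z - j (b z)) Wz : U); rewrite /= linearB /= pj subr0.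
by move=> /(congr1 val) /= ->; rewrite subrK.
Qed.

Variable S : set (lendo U).

(* In block form along [V = W + 'rV_n], with [f] given by [s] on [W], [h] from
   ['rV_n] to [W] and [A] on ['rV_n], the inner inverse is the inverse of [s]
   plus an invertible inner inverse [B] of [A], followed by the
   automorphism [j c |-> j c - s^-1 (h c)], which clears [h]. *)
Lemma LS_regular_of_Aut : Aut_subgroup S -> finite_dim (quotmod W) ->
  forall f, LS S f -> exists u v : lendo V,
    [/\ LS S u, LS S v, cancel u v, cancel v u & forall x, f (u (f x)) = f x].
Proof.
move=> [S_Aut S1 _ S_inv] fdQ f /LS_restrictP[s Ss fs].
have [t sK tK] := lin_Aut_inverse (S_Aut _ Ss).
have St : S t by apply: S_inv sK tK.
have [n [p [b [j [pK jK bW pj split_x]]]]] := finite_codim_decomposition fdQ.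
pose A := lin1_mx (b \o f \o j).
have AE c : c *m A = b (f (j c)) by rewrite mul_rV_lin1.
have [B B_unit ABA] := mulmx_inner_inverse A.
have bval w c : b (val (w : U) + j c) = c by rewrite linearD /= bW jK add0r.
have pval w c : p (val (w : U) + j c) = w by rewrite linearD /= pK pj addr0.
have bf x : b (f x) = b x *m A.
  by rewrite {1}[x]split_x !linearD /= fs bW add0r AE.
have pf x : p (f x) = s (p x) + p (f (j (b x))).
  by rewrite {1}[x]split_x !linearD /= fs pK.
(* [k] is the new ['rV_n] coordinate; [l] is the [W] component that [f] produces from it, subtracted
   before [t] acts. *)
pose k : {linear V -> 'rV[K]_n} := GRing.Linear.clone _ _ _ _ (mulmxr B \o b) _.
pose l : {linear V -> U} := GRing.Linear.clone _ _ _ _ (p \o f \o j \o k) _.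
have lu : linear (fun x => val (t (p x - l x)) + j (k x)).
  move=> a x y; rewrite (linearP k) (linearP l) (linearP p) opprD addrACA.
  by rewrite -scalerBr (linearP t) (linearP j) linearP /= addrACA -scalerDr.
(* Inverting [u] adds [p (f (j (b x)))] to [s (p x)]; by [pf] the sum is [p (f x)]. *)
have lv : linear (fun x => val (p (f x)) + j (b x *m invmx B)).
  move=> a x y; rewrite !linearP /= mulmxDl -scalemxAl linearP.
  by rewrite addrACA -scalerDr.
have [u uE] : exists u : lendo V, forall x,
    u x = val (t (p x - p (f (j (b x *m B))))) + j (b x *m B).
  exact: linear_fun_ex lu.
have [v vE] := linear_fun_ex lv.
have fu x : f (u x) = val (p x) + j (b x *m B *m A).
  rewrite [LHS]split_x bf pf !uE bval pval tK; congr (val _ + _).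
  by rewrite subrK.
exists u, v; split.
- apply/LS_restrictP; exists t => // w.
  by rewrite uE pK bW mul0mx !linear0 !addr0.
- apply/LS_restrictP; exists s => // w.
  by rewrite vE fs pK bW mul0mx linear0 addr0.
- move=> x; rewrite vE fu pval uE bval -mulmxA mulmxV // mulmx1.
  by rewrite -split_x.
- move=> x; rewrite uE vE bval pval -mulmxA mulVmx // mulmx1.
  by rewrite pf addrK sK -split_x.
- move=> x; rewrite fu bf -[_ *m B *m A]mulmxA -mulmxA (mulmxA A) ABA.
  by rewrite -bf -split_x.
Qed.

(** Here [val] is an isomorphism with inverse [p], and inner inverses transport by conjugation. *)
Lemma LS_regular_of_full : W =i predT ->
  (forall f, S f -> exists u v : lendo U,
    [/\ S u, S v, cancel u v, cancel v u & forall x, f (u (f x)) = f x]) ->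
  forall f, LS S f -> exists u v : lendo V,
    [/\ LS S u, LS S v, cancel u v, cancel v u & forall x, f (u (f x)) = f x].
Proof.
move=> WT regS f /LS_restrictP[s Ss fs].
have [p pK] := submod_retraction W.
have valpK x : val (p x) = x.
  have Wx : x \in W by rewrite WT.
  by rewrite -[x]/(val (Sub x Wx : U)) pK.
have ext (g : lendo U) : exists h : lendo V, forall x, h x = val (g (p x)).
  by exists (GRing.Linear.clone _ _ _ _ ((val : U -> V) \o g \o p) _).
have [u [v [Su Sv uK vK sus]]] := regS _ Ss.
have [u' uE] := ext u; have [v' vE] := ext v; exists u', v'; split.
- by apply/LS_restrictP; exists u => // w; rewrite uE pK.
- by apply/LS_restrictP; exists v => // w; rewrite vE pK.
- by move=> x; rewrite vE uE pK uK.
- by move=> x; rewrite vE uE pK vK.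
- by move=> x; rewrite -{1 2}[x]valpK fs uE pK fs sus -fs valpK.
Qed.

End AutStable.

Theorem theorem4p8 (K : fieldType) (V : lmodType K) (W : submodClosed V)
    (S : set (lendo (submod_of W)))
    (S_mul : subsemigroup S) (S_one : S 1%g) :
  unit_regular (LS S) <->
  (Aut_subgroup S /\ finite_dim (quotmod W)) \/
  (unit_regular S /\ W =i predT).
Proof.
rewrite (unit_regular_lendoP (LS_one S_one)) (unit_regular_lendoP S_one).
split=> [regLS|[[S_Aut fdQ]|[regS WT]]].
- have [WT|] := pselect (W =i predT).
    by right; split=> //; apply: LS_regular_restrict.
  move=> /existsNP[v Wv]; left; split; last exact: LS_regular_codim regLS.
  by apply: (LS_regular_Aut S_one regLS (v := v)) => //; apply/negP => vW; apply: Wv.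
- exact: LS_regular_of_Aut.
- exact: LS_regular_of_full.
Qed.
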